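(* Let $a\in L^{N/2}(\mathbb{R}^N)$, $a\ge 0$, $a\ne 0$, $\lim_{|x|\to\infty}a(x)=0$, and let $b\in L^{\infty}(\mathbb{R}^N)$, $b\ge 0$, $b\ne 0$, $\lim_{|x|\to\infty}b(x)=0$. Then the map $\lambda\in\mathbb{R}^+\mapsto m_\lambda$ is monotone non-decreasing.
   Context: $N\ge 2$ is an integer; $p>1$, and $p<\frac{N+2}{N-2}$ if $N\ge 3$; $a_\infty>0$ and $b_\infty>0$ are constants; $\mathbb{R}^+=[0,+\infty)$. On $H^1(\mathbb{R}^N)$, $$I_\lambda(u)=\frac12\int_{\mathbb{R}^N}|\nabla u|^2+(a_\infty+\lambda a(x))u^2-\frac1{p+1}\int_{\mathbb{R}^N}(b_\infty+b(x))|u|^{p+1},$$ $\mathcal{N}_\lambda=\{u\in H^1(\mathbb{R}^N)\setminus\{0\}: I_\lambda'(u)[u]=0\}$, and $m_\lambda=\inf\{I_\lambda(u):u\in\mathcal{N}_\lambda\}$. *)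

(* Defs.v *)
From HB Require Import structures.
From mathcomp Require Import all_boot all_order all_algebra.
From mathcomp Require Import all_classical all_reals all_analysis.

Set Implicit Arguments.
Unset Strict Implicit.
Unset Printing Implicit Defensive.

Import Order.TTheory GRing.Theory Num.Theory.
Import numFieldNormedType.Exports.

Local Open Scope classical_set_scope.
Local Open Scope ring_scope.

(* The sigma-algebra generated by the coordinates, i.e. the Borel one. *)
Definition rV_display : measure_display.
Proof. exact: default_measure_display. Qed.

Section measurable_rV.
Variables (R : realType) (n : nat).

Let coors : 'I_n -> 'rV[R]_n -> measurableTypeR R := fun i x => x ord0 i.

Let rV_set0 : g_sigma_preimage coors set0.
Proof. exact: sigma_algebra0. Qed.

Let rV_setC A : g_sigma_preimage coors A -> g_sigma_preimage coors (~` A).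
Proof. exact: sigma_algebraC. Qed.

Let rV_bigcup (F : _^nat) : (forall i, g_sigma_preimage coors (F i)) ->
  g_sigma_preimage coors (\bigcup_i (F i)).
Proof. exact: sigma_algebra_bigcup. Qed.

HB.instance Definition _ := @isMeasurable.Build rV_display
  'rV[R]_n (g_sigma_preimage coors) rV_set0 rV_setC rV_bigcup.

Lemma measurable_rV_coord (i : 'I_n) :
  measurable_fun [set: 'rV[R]_n] (fun x : 'rV[R]_n => x ord0 i).
Proof.
move=> _ Y mY; rewrite setTI; apply: sub_sigma_algebra => /=.
rewrite -bigcup_seq/=; exists i => /=; first by rewrite mem_index_enum.
by exists Y => //; rewrite setTI.
Qed.

Lemma measurable_fun_rV d (T : measurableType d) (f : T -> 'rV[R]_n) :
  (forall i, measurable_fun [set: T] (fun x => f x ord0 i)) ->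
  measurable_fun [set: T] f.
Proof.
move=> mf.
have mS : g_sigma_preimage (fun i => coors i \o f) `<=` measurable.
  apply: smallest_sub; first exact: sigma_algebra_measurable.
  rewrite -bigcup_seq; apply: bigcup_sub => i _ A [B mB <-].
  exact: mf.
move=> _ A mA; apply: mS; rewrite g_sigma_preimage_comp.
by exists A.
Qed.

End measurable_rV.

Section lebesgue_rV.
Variable R : realType.

Definition rV_cons n (p : measurableTypeR R * 'rV[R]_n) : 'rV[R]_n.+1 :=
  \row_i oapp (fun j => p.2 ord0 j) p.1 (unlift ord0 i).

Definition rV_uncons n (x : 'rV[R]_n.+1) : measurableTypeR R * 'rV[R]_n :=
  (x ord0 ord0, \row_i x ord0 (lift ord0 i)).

Lemma rV_cons0 n p : @rV_cons n p ord0 ord0 = p.1.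
Proof. by rewrite mxE unlift_none. Qed.

Lemma rV_consS n p i : @rV_cons n p ord0 (lift ord0 i) = p.2 ord0 i.
Proof. by rewrite mxE liftK. Qed.

Lemma rV_unconsK n : cancel (@rV_uncons n) (@rV_cons n).
Proof.
move=> x; apply/rowP => i; case: (unliftP ord0 i) => [j ->|->].
  by rewrite rV_consS mxE.
by rewrite rV_cons0.
Qed.

Lemma rV_consK n : cancel (@rV_cons n) (@rV_uncons n).
Proof.
case=> a x; rewrite /rV_uncons rV_cons0; congr pair.
by apply/rowP => i; rewrite mxE rV_consS.
Qed.

Lemma measurable_rV_cons n : measurable_fun setT (@rV_cons n).
Proof.
apply: measurable_fun_rV => i; case: (unliftP ord0 i) => [j ->|->].
  under eq_fun do rewrite rV_consS.
  apply: (@measurableT_comp _ _ _ _ _ _ (fun x : 'rV[R]_n => x ord0 j)).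
    exact: measurable_rV_coord.
  exact: measurable_snd.
by under eq_fun do rewrite rV_cons0; exact: measurable_fst.
Qed.

Lemma measurable_rV_uncons n : measurable_fun setT (@rV_uncons n).
Proof.
apply: measurable_fun_pair; first exact: measurable_rV_coord.
apply: measurable_fun_rV => i.
rewrite [X in measurable_fun _ X](_ : _ =
  (fun x : 'rV[R]_n.+1 => x ord0 (lift ord0 i))); last first.
  by apply/funext => x; rewrite mxE.
exact: measurable_rV_coord.
Qed.

Section lebesgue_succ.
Variables (n : nat) (mu : {sigma_finite_measure set 'rV[R]_n -> \bar R}).

Definition lebesgue_succ : set 'rV[R]_n.+1 -> \bar R :=
  pushforward (lebesgue_measure \x mu)%E (@rV_cons n).

Let measurable_preimage_cons A : measurable A -> measurable (@rV_cons n @^-1` A).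
Proof. by move=> mA; rewrite -[X in measurable X]setTI; exact: measurable_rV_cons. Qed.

Let lebesgue_succ0 : lebesgue_succ set0 = 0%E.
Proof. by rewrite /lebesgue_succ /pushforward preimage_set0 measure0. Qed.

Let lebesgue_succ_ge0 A : (0 <= lebesgue_succ A)%E.
Proof. by rewrite /lebesgue_succ /pushforward measure_ge0. Qed.

Let lebesgue_succ_sigma_additive : semi_sigma_additive lebesgue_succ.
Proof.
move=> F mF tF mUF; rewrite /lebesgue_succ /pushforward preimage_bigcup.
apply: measure_semi_sigma_additive.
- by move=> k; exact: measurable_preimage_cons.
- apply/trivIsetP => /= i j _ _ ij; rewrite -preimage_setI.
  by move/trivIsetP : tF => /(_ _ _ _ _ ij) ->//; rewrite preimage_set0.
- by rewrite -preimage_bigcup; exact: measurable_preimage_cons.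
Qed.

HB.instance Definition _ := isMeasure.Build _ _ _ lebesgue_succ
  lebesgue_succ0 lebesgue_succ_ge0 lebesgue_succ_sigma_additive.

Let lebesgue_succ_sigma_finite : sigma_finite setT lebesgue_succ.
Proof.
have /sigma_finiteP[F [TF ndF Foo]] := sigma_finiteT (@lebesgue_measure R).
have /sigma_finiteP[G [TG ndG Goo]] := sigma_finiteT mu.
exists (fun k => @rV_uncons n @^-1` (F k `*` G k)).
  rewrite -preimage_bigcup -(preimage_setT (@rV_uncons n)); congr (_ @^-1` _).
  rewrite -setXTT TF TG; apply/seteqP; split => -[x y].
    move=> [/= [k _ Fkx] [l _ Gly]]; exists (maxn k l) => //; split.
    - by move: x Fkx; exact/subsetPset/ndF/leq_maxl.
    - by move: y Gly; exact/subsetPset/ndG/leq_maxr.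
  by move=> [k _ []/= ? ?]; split; exists k.
move=> k; have [mF Fk] := Foo k; have [mG Gk] := Goo k; split.
  rewrite -[X in measurable X]setTI; apply: measurable_rV_uncons => //.
  exact: measurableX.
rewrite /lebesgue_succ /pushforward -comp_preimage.
rewrite (_ : _ \o _ = id) ?preimage_id; last first.
  by apply/funext => x /=; rewrite rV_consK.
by rewrite product_measure1E// lte_mul_pinfty// ge0_fin_numE.
Qed.

HB.instance Definition _ := Measure_isSigmaFinite.Build _ _ _ lebesgue_succ
  lebesgue_succ_sigma_finite.

End lebesgue_succ.

Fixpoint lebesgue_rV (n : nat) : {sigma_finite_measure set 'rV[R]_n -> \bar R} :=
  match n with
  | 0%N => dirac (0 : 'rV[R]_0)
  | m.+1 => lebesgue_succ (lebesgue_rV m)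
  end.

(* Measurable rectangles form a pi-system generating the sigma-algebra, so this
   identifies lebesgue_rV n as the n-dimensional Lebesgue measure. *)
Lemma lebesgue_rV_box n (A : 'I_n -> set (measurableTypeR R)) :
  (forall i, measurable (A i)) ->
  lebesgue_rV n [set x | forall i, A i (x ord0 i)] =
  (\prod_(i < n) lebesgue_measure (A i))%E.
Proof.
elim: n A => [|n IH] A mA.
  rewrite big_ord0 /= diracE mem_set//=; by case.
rewrite big_ord_recl -IH//= /lebesgue_succ /pushforward -product_measure1E//=.
  congr (_ _); apply/seteqP; split => -[u x] /=.
    move=> H; split => [|i]; first by have := H ord0; rewrite rV_cons0.
    by have := H (lift ord0 i); rewrite rV_consS.
  move=> [Hu Hx] i; case: (unliftP ord0 i) => [j ->|->].
    by rewrite rV_consS; exact: Hx.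
  by rewrite rV_cons0.
rewrite [X in measurable X](_ : _ = \bigcap_(i in [set: 'I_n])
   ((fun x : 'rV[R]_n => x ord0 i) @^-1` A (lift ord0 i))); last first.
  apply/seteqP; split => [x /= H i _|x /= H i]; [exact: H|exact: (H i Logic.I)].
apply: fin_bigcap_measurable => // i _.
rewrite -[X in measurable X]setTI; apply: measurable_rV_coord => //; exact: mA.
Qed.

End lebesgue_rV.

Section Nehari.
Variables (R : realType) (N : nat).

Local Notation E := ('rV[R]_N).
Local Notation mu := (lebesgue_rV R N).

(* The Euclidean norm; the library norm on 'rV[R]_N is the sup norm. *)
Definition enorm (x : E) : R := Num.sqrt (\sum_(i < N) x ord0 i ^+ 2).

Definition partial (i : 'I_N) (f : E -> R) : E -> R :=
  'D_(delta_mx ord0 i) f.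

(* Iterated partial derivatives of every order exist and are continuous. *)
Definition smooth (f : E -> R) : Prop :=
  forall s : seq 'I_N,
    continuous (foldr partial f s) /\
    forall (i : 'I_N) (x : E),
      derivable (foldr partial f s) x (delta_mx ord0 i).

Definition test_function (f : E -> R) : Prop :=
  smooth f /\ compact (closure [set x | f x != 0]).

Definition weak_partial (i : 'I_N) (u g : E -> R) : Prop :=
  forall f : E -> R, test_function f ->
    (\int[mu]_x (u x * partial i f x) = - \int[mu]_x (g x * f x))%R.

(* An element of H^1 is represented by a pair (u, grad u), the weak gradient
   being determined by u up to a null set. *)
Definition H1 : set ((E -> R) * (E -> E)) :=
  [set w : (E -> R) * (E -> E) | w.1 \in Lfun mu 2%:E /\
    forall i : 'I_N, (fun x : E => w.2 x ord0 i) \in Lfun mu 2%:E /\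
                     weak_partial i w.1 (fun x : E => w.2 x ord0 i)].

Definition ae_vanishes_at_infinity (f : E -> R) : Prop :=
  forall e : R, 0 < e ->
    exists M : R, {ae mu, forall x, M < enorm x -> `|f x| < e}.

(* I_lambda takes the value +oo when a * u ^ 2 is not integrable, which
   for N = 2 is not excluded by a in L^{N/2} and u in H^1. *)
Definition energy (ainf binf p : R) (a b : E -> R) (lambda : R)
    (w : (E -> R) * (E -> E)) : \bar R :=
  ((2^-1)%:E * (\int[mu]_x
      (enorm (w.2 x) ^+ 2 + (ainf + lambda * a x) * w.1 x ^+ 2)%:E)
   - ((p + 1)^-1)%:E * (\int[mu]_x
      ((binf + b x) * `|w.1 x| `^ (p + 1))%:E))%E.

(* F'(w)[v] = l, with F finite along the direction v near w. *)
Definition is_dir_derive (F : (E -> R) * (E -> E) -> \bar R)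
    (w v : (E -> R) * (E -> E)) (l : R) : Prop :=
  (\forall t \near (0 : R), F (w + t *: v) \is a fin_num) /\
  is_derive (0 : R) (1 : R) (fun t : R => fine (F (w + t *: v))) l.

Definition nehari (ainf binf p : R) (a b : E -> R) (lambda : R) :
    set ((E -> R) * (E -> E)) :=
  [set w : (E -> R) * (E -> E) | H1 w /\ ~ {ae mu, forall x, w.1 x = 0} /\
           is_dir_derive (energy ainf binf p a b lambda) w w 0].

Definition nehari_level (ainf binf p : R) (a b : E -> R) (lambda : R) : \bar R :=
  ereal_inf (energy ainf binf p a b lambda @` nehari ainf binf p a b lambda).

End Nehari.

(* Main.v *)
(* Write Q for the quadratic term of the energy of u and P for the integral of
   (binf + b) |u| ^ (p + 1).  The energy of k u is
   k ^ 2 Q / 2 - |k| ^ (p + 1) P / (p + 1), so the Nehari condition reads Q = P,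
   and then the energy is (1 / 2 - 1 / (p + 1)) Q.  Since a >= 0, Q is
   nondecreasing in lambda, while P does not depend on it; hence a point u of
   the Nehari set for lambda2 is sent into the one for lambda1 <= lambda2 by the
   factor s = (Q1 / Q2) ^ (1 / (p - 1)) <= 1, and the energy does not increase.
   Finiteness of Q and P, which Sobolev embeddings do not give for a u ^ 2 when
   N = 2, comes from finiteness of the energy at u. *)
Require Import Defs.
From mathcomp Require Import all_boot all_order all_algebra.
From mathcomp Require Import all_classical all_reals all_analysis.
From mathcomp Require Import measurable_realfun ring lra.

Import Order.TTheory GRing.Theory Num.Theory.
Import numFieldNormedType.Exports.

Local Open Scope classical_set_scope.
Local Open Scope ring_scope.

(** * Integrals of functions that are nonnegative almost everywhere *)

Section ae_nonnegative.
Context d (T : measurableType d) (R : realType).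
Variable mu : {measure set T -> \bar R}.
Implicit Types f g : T -> R.

(** Signs of [a] and [b] are known only almost everywhere; passing to the absolute value gives an
    integrand nonnegative at every point, as the theory of nonnegative integrals requires. *)
Lemma ae_ge0_integral_norm f : measurable_fun setT f ->
  {ae mu, forall x, 0 <= f x} ->
  (\int[mu]_x (f x)%:E = \int[mu]_x `|f x|%:E)%E.
Proof.
move=> mf f0; apply: ae_eq_integral => //.
- exact/measurable_EFinP.
- by apply/measurable_EFinP; exact: measurableT_comp.
- by apply: filterS f0 => x fx0 _; rewrite ger0_norm.
Qed.

Lemma ae_ge0_integral_ge0 f : measurable_fun setT f ->
  {ae mu, forall x, 0 <= f x} -> (0 <= \int[mu]_x (f x)%:E)%E.
Proof.
move=> mf f0; rewrite ae_ge0_integral_norm//.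
by apply: integral_ge0 => x _; rewrite lee_fin.
Qed.

(** The sign condition takes the place of integrability, so an infinite integral is covered too. *)
Lemma ae_ge0_integralZl f (k : R) : measurable_fun setT f ->
  {ae mu, forall x, 0 <= f x} -> 0 <= k ->
  (\int[mu]_x (k * f x)%:E = k%:E * \int[mu]_x (f x)%:E)%E.
Proof.
move=> mf f0 k0; rewrite [in RHS]ae_ge0_integral_norm//.
rewrite ae_ge0_integral_norm; last 2 first.
- exact: measurable_funM.
- by apply: filterS f0 => x fx0; rewrite mulr_ge0.
under eq_integral do rewrite normrM (ger0_norm k0) EFinM.
rewrite ge0_integralZl_EFin//.
by apply/measurable_EFinP; exact: measurableT_comp.
Qed.

Lemma ae_ge0_integral_le f g : measurable_fun setT f -> measurable_fun setT g ->
  {ae mu, forall x, 0 <= f x} -> {ae mu, forall x, f x <= g x} ->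
  (\int[mu]_x (f x)%:E <= \int[mu]_x (g x)%:E)%E.
Proof.
move=> mf mg f0 fg; rewrite (ae_ge0_integral_norm f)//.
rewrite (ae_ge0_integral_norm g)//; last first.
  by apply: filterS2 f0 fg => x; exact: le_trans.
apply: ae_ge0_le_integral => //.
- by apply/measurable_EFinP; exact: measurableT_comp.
- by apply/measurable_EFinP; exact: measurableT_comp.
- apply: filterS2 f0 fg => x f0 fg _.
  by rewrite lee_fin !ger0_norm// (le_trans f0).
Qed.

Lemma ae_ge0_integral_eq0 f : measurable_fun setT f ->
  {ae mu, forall x, 0 <= f x} -> (\int[mu]_x (f x)%:E = 0)%E ->
  {ae mu, forall x, f x = 0}.
Proof.
move=> mf f0; rewrite ae_ge0_integral_norm// => If.
have /(ae_eq_integral_abs mu measurableT) : measurable_fun setT (EFin \o f).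
  exact/measurable_EFinP.
by move=> [/(_ If) + _]; apply: filterS => x /(_ Logic.I) [].
Qed.

End ae_nonnegative.

(** * Stability of test functions, weak derivatives and [H1] under nonzero scaling *)

Section test_functions.
Variables (R : realType) (N : nat).
Implicit Types (f : 'rV[R]_N -> R) (s : seq 'I_N).

Lemma foldr_partialZ k f s : smooth f ->
  foldr (@partial R N) (k \*: f) s = k \*: foldr (@partial R N) f s.
Proof.
move=> sf; elim: s => //= i s ->; apply/funext => x.
by rewrite /partial deriveZ//; have [_] := sf s; exact.
Qed.

Lemma test_functionZ k f : k != 0 -> test_function f -> test_function (k \*: f).
Proof.
move=> k0 [sf cf]; split; last first.
  (* A nonzero factor leaves the support unchanged. *)
  rewrite (_ : [set x | _] = [set x | f x != 0])//.
  by apply/seteqP; split=> x /=; rewrite scaler_eq0 negb_or k0.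
move=> s; rewrite foldr_partialZ//; have [cs ds] := sf s; split.
  by move=> x; exact: (cvgZl_tmp (cs x)).
by move=> i x; exact: derivableZ.
Qed.

Lemma weak_partialZ k (i : 'I_N) (u g : 'rV[R]_N -> R) : k != 0 ->
  weak_partial i u g -> weak_partial i (k *: u) (k *: g).
Proof.
(* The scalar moves to the test function, so no integrability is needed. *)
move=> k0 ug f tf.
have := ug _ (test_functionZ _ _ k0 tf).
rewrite (foldr_partialZ k f [:: i] tf.1 : partial i _ = _) => ugf.
transitivity (\int[lebesgue_rV R N]_x (u x * (k \*: partial i f) x)).
  by apply: eq_Rintegral => x _; rewrite mulrCA mulrA.
rewrite {}ugf; congr (- _).
by apply: eq_Rintegral => x _; rewrite mulrCA mulrA.
Qed.

Lemma H1Z k (w : ('rV[R]_N -> R) * ('rV[R]_N -> 'rV[R]_N)) : k != 0 ->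
  H1 w -> H1 (k *: w).
Proof.
move=> k0 [w1 w2]; have le12 : (1 <= 2%:E :> \bar R)%E by rewrite lee_fin ler1n.
have LZ f : f \in Lfun (lebesgue_rV R N) 2%:E ->
    k *: f \in Lfun (lebesgue_rV R N) 2%:E.
  have [L0 LD] := Lfun_submod_closed (lebesgue_rV R N) le12 => Lf.
  (* Closure of a submodule is phrased for [k *: f + g]; here [g] is 0. *)
  by rewrite -[_ *: f]addr0; exact: LD.
split; first exact: LZ.
move=> i; rewrite (_ : (fun x => _) = k *: (fun x => w.2 x ord0 i)); last first.
  by apply/funext => x; rewrite /= mxE.
by have [wi wpi] := w2 i; split; [exact: LZ|exact: weak_partialZ].
Qed.

End test_functions.

(** * Computations for the energy along a ray *)

Lemma sqr_enorm (R : realType) (N : nat) (x : 'rV[R]_N) :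
  enorm x ^+ 2 = \sum_(i < N) x ord0 i ^+ 2.
Proof. by rewrite sqr_sqrtr// sumr_ge0// => i _; exact: sqr_ge0. Qed.

Lemma sqr_enormZ (R : realType) (N : nat) (k : R) (x : 'rV[R]_N) :
  enorm (k *: x) ^+ 2 = k ^+ 2 * enorm x ^+ 2.
Proof.
by rewrite !sqr_enorm mulr_sumr; apply: eq_bigr => i _; rewrite mxE exprMn.
Qed.

Lemma mule_fin_num_gt0 (R : realType) (c : R) (x : \bar R) : 0 < c ->
  (0 <= x)%E -> (c%:E * x)%E \is a fin_num -> x \is a fin_num.
Proof. by case: x => //= c0 _; rewrite mulry gtr0_sg// mul1e. Qed.

(** This is the energy at [(1 + t) *: w] when [w] has quadratic term [q] and potential term [r].
    Differentiating the powers produces factors 2 and [p + 1], which cancel the coefficients. *)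
Lemma is_derive_fiber (R : realType) (p q r : R) : 1 < p ->
  is_derive (0 : R) (1 : R) (fun t : R => 2^-1 * ((1 + t) ^+ 2 * q) -
    (p + 1)^-1 * (`|1 + t| `^ (p + 1) * r)) (q - r).
Proof.
move=> p_gt1.
have D1 : is_derive (0 : R) (1 : R) (fun t : R => 1 + t) 1.
  have := is_deriveD (is_derive_cst (1 : R) (0 : R) (1 : R))
    (is_derive_id (0 : R) (1 : R)).
  by rewrite add0r.
have D2 : is_derive (0 : R) (1 : R) (fun t : R => (1 + t) `^ (p + 1)) (p + 1).
  have D : is_derive (1 + 0 : R) (1 : R) (@powR R ^~ (p + 1)) (p + 1).
    rewrite addr0; have := @is_derive1_powR R (p + 1) 1 ltr01.
    by rewrite powR1 mulr1.
  by have := is_derive1_comp D D1; rewrite mulr1.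
apply: (@near_eq_is_derive _ _ _ ((2^-1 * q) \*: (fun t : R => 1 + t) ^+ 2
    - ((p + 1)^-1 * r) \*: (fun t : R => (1 + t) `^ (p + 1)))).
  near=> t.
  have t1 : 0 < 1 + t.
    rewrite -ltrBlDl sub0r; near: t; apply: lt_nbhsr; lra.
  rewrite ger0_norm ?(ltW t1)//=.
  rewrite -[LHS]/(2^-1 * q * (1 + t) ^+ 2 -
    (p + 1)^-1 * r * (1 + t) `^ (p + 1)).
  ring.
apply: (is_derive_eq (is_deriveB (is_deriveZ _ (is_deriveX 2 D1))
  (is_deriveZ _ D2))).
rewrite /GRing.scale /= addr0 expr1 !mulr1; field; lra.
Unshelve. all: by end_near.
Qed.

(** * The Nehari condition and projection along rays *)

Section scaling.
Variables (R : realType) (N : nat) (ainf binf p : R) (a b : 'rV[R]_N -> R).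
Local Notation mu := (lebesgue_rV R N).
Local Notation E := (('rV[R]_N -> R) * ('rV[R]_N -> 'rV[R]_N))%type.
Hypothesis p_gt1 : 1 < p.
Hypotheses (ainf_gt0 : 0 < ainf) (binf_gt0 : 0 < binf).
Hypotheses (ma : measurable_fun setT a) (mb : measurable_fun setT b).
Hypothesis a_ge0 : {ae mu, forall x, 0 <= a x}.
Hypothesis b_ge0 : {ae mu, forall x, 0 <= b x}.
Implicit Types (l k : R) (w : E).

Let quad_fun l w x := enorm (w.2 x) ^+ 2 + (ainf + l * a x) * w.1 x ^+ 2.
Let pot_fun w x := (binf + b x) * `|w.1 x| `^ (p + 1).
Let quad l w := (\int[mu]_x (quad_fun l w x)%:E)%E.
Let pot w := (\int[mu]_x (pot_fun w x)%:E)%E.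

Let energyE l w : energy ainf binf p a b l w =
  ((2^-1)%:E * quad l w - ((p + 1)^-1)%:E * pot w)%E.
Proof. by []. Qed.

Let measurable_H1 w : H1 w -> measurable_fun setT w.1 /\
  measurable_fun setT (fun x => enorm (w.2 x) ^+ 2).
Proof.
move=> [/sub_Lfun_mfun]; rewrite inE => m1 m2; split=> //.
under eq_fun do rewrite sqr_enorm.
apply: measurable_sum => i; apply: measurable_funX.
by have [/sub_Lfun_mfun] := m2 i; rewrite inE.
Qed.

Let measurable_quad l w : H1 w -> measurable_fun setT (quad_fun l w).
Proof.
move=> /measurable_H1[m1 m2]; apply: measurable_funD => //.
apply: measurable_funM; last exact: measurable_funX.
by apply: measurable_funD => //; exact: measurable_funM.
Qed.

Let measurable_pot w : H1 w -> measurable_fun setT (pot_fun w).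
Proof.
move=> /measurable_H1[m1 _]; apply: measurable_funM.
  exact: measurable_funD.
apply: (@measurableT_comp _ _ _ _ _ _ (@powR R ^~ (p + 1))).
  exact: measurable_powR.
exact: measurableT_comp.
Qed.

Let quad_fun_ge0 l w : 0 <= l -> {ae mu, forall x, 0 <= quad_fun l w x}.
Proof.
move=> l0; apply: filterS a_ge0 => x ax0.
rewrite addr_ge0 ?sqr_ge0// mulr_ge0 ?sqr_ge0// addr_ge0 ?(ltW ainf_gt0)//.
by rewrite mulr_ge0.
Qed.

Let pot_fun_ge0 w : {ae mu, forall x, 0 <= pot_fun w x}.
Proof.
apply: filterS b_ge0 => x bx0.
by rewrite mulr_ge0 ?powR_ge0// addr_ge0// ltW.
Qed.

Let quadZ l k w : 0 <= l -> H1 w ->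
  quad l (k *: w) = ((k ^+ 2)%:E * quad l w)%E.
Proof.
move=> l0 Hw; rewrite /quad -ae_ge0_integralZl ?sqr_ge0//; last 2 first.
- exact: measurable_quad.
- exact: quad_fun_ge0.
apply: eq_integral => x _; congr EFin.
by rewrite /quad_fun /= sqr_enormZ -[(k *: w.1) x]/(k * w.1 x); ring.
Qed.

Let potZ k w : H1 w -> pot (k *: w) = ((`|k| `^ (p + 1))%:E * pot w)%E.
Proof.
move=> Hw; rewrite /pot -ae_ge0_integralZl ?powR_ge0//; last first.
  exact: measurable_pot.
apply: eq_integral => x _; congr EFin.
rewrite /pot_fun /= -[(k *: w.1) x]/(k * w.1 x) normrM powRM//; ring.
Qed.

Let quad_ge0 l w : 0 <= l -> H1 w -> (0 <= quad l w)%E.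
Proof.
move=> l0 Hw.
by apply: ae_ge0_integral_ge0; [exact: measurable_quad|exact: quad_fun_ge0].
Qed.

Let pot_ge0 w : H1 w -> (0 <= pot w)%E.
Proof.
by move=> Hw; apply: ae_ge0_integral_ge0; first exact: measurable_pot.
Qed.

(** If the integral were 0, the integrand would vanish almost everywhere, and its coefficient
    [ainf + l * a x], at least [ainf > 0], would force [w.1] to vanish. *)
Let quad_gt0 l w : 0 <= l -> H1 w -> ~ {ae mu, forall x, w.1 x = 0} ->
  (0 < quad l w)%E.
Proof.
move=> l0 Hw w0; rewrite lt0e quad_ge0// andbT; apply/eqP => q0; apply: w0.
have := ae_ge0_integral_eq0 _ _ _ mu _ (measurable_quad l w Hw)
  (quad_fun_ge0 _ w l0) q0.
apply: filterS2 a_ge0 => x ax0 /eqP.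
have al0 : 0 < ainf + l * a x by rewrite ltr_wpDr// mulr_ge0.
rewrite paddr_eq0 ?sqr_ge0//; last by rewrite mulr_ge0 ?sqr_ge0// ltW.
by move=> /andP[_]; rewrite mulf_eq0 gt_eqF//= sqrf_eq0 => /eqP.
Qed.

Let le_quad l1 l2 w : 0 <= l1 -> l1 <= l2 -> H1 w -> (quad l1 w <= quad l2 w)%E.
Proof.
move=> l10 l12 Hw; apply: ae_ge0_integral_le.
- exact: measurable_quad.
- exact: measurable_quad.
- exact: quad_fun_ge0.
- apply: filterS a_ge0 => x ax0.
  by rewrite lerD2l ler_wpM2r ?sqr_ge0// lerD2l ler_wpM2r.
Qed.

(** Since [w + t *: w] is [(1 + t) *: w], the derivative along [w] is the difference of the
    quadratic and potential terms, once both are known to be finite. *)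
Lemma nehari_conditionP l w : 0 <= l -> H1 w ->
  is_dir_derive (energy ainf binf p a b l) w w 0 <->
  exists q : R, quad l w = q%:E /\ pot w = q%:E.
Proof.
move=> l0 Hw.
have wE (t : R) : w + t *: w = (1 + t) *: w by rewrite scalerDl scale1r.
have EZ (q r t : R) : quad l w = q%:E -> pot w = r%:E ->
    energy ainf binf p a b l (w + t *: w) = (2^-1 * ((1 + t) ^+ 2 * q) -
      (p + 1)^-1 * (`|1 + t| `^ (p + 1) * r))%:E.
  by move=> qE rE; rewrite wE energyE quadZ// potZ// qE rE.
split=> [[/nbhs_singleton]|[q [qE rE]]]; last first.
  split; first by near=> t; rewrite (EZ _ _ _ qE rE).
  rewrite (_ : (fun t : R => _) = (fun t : R => 2^-1 * ((1 + t) ^+ 2 * q) -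
      (p + 1)^-1 * (`|1 + t| `^ (p + 1) * q))); last first.
    by apply/funext => t; rewrite (EZ _ _ _ qE rE).
  by have := is_derive_fiber _ _ q q p_gt1; rewrite subrr.
(* Finiteness near [t = 0] is used at [t = 0] itself, that is, at [w]. *)
rewrite scale0r addr0 energyE => finE.
have p1 : 0 < (p + 1)^-1 by rewrite invr_gt0 addr_gt0// (lt_trans ltr01).
have h2 : 0 < 2^-1 :> R by rewrite invr_gt0.
(* In \bar R, +oo - +oo is -oo, so both terms of the energy are finite. *)
move: finE; rewrite fin_numB => /andP[].
move=> /(mule_fin_num_gt0 _ _ _ h2 (quad_ge0 _ _ l0 Hw))/fineK/esym qE.
move=> /(mule_fin_num_gt0 _ _ _ p1 (pot_ge0 _ Hw))/fineK/esym rE.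
set q := fine _ in qE; set r := fine _ in rE.
rewrite (_ : (fun t : R => _) = (fun t : R => 2^-1 * ((1 + t) ^+ 2 * q) -
      (p + 1)^-1 * (`|1 + t| `^ (p + 1) * r))); last first.
  by apply/funext => t; rewrite (EZ _ _ _ qE rE).
(* The derivative is unique, so [q - r] must be 0. *)
move=> [_ D0]; have [_] := is_derive_fiber _ _ q r p_gt1.
rewrite D0 => /esym/eqP; rewrite subr_eq0 => /eqP qr.
by exists q; rewrite qE rE qr.
Unshelve. all: by end_near.
Qed.

Lemma nehari_projection l1 l2 w : 0 <= l1 -> l1 <= l2 ->
  nehari ainf binf p a b l2 w ->
  exists2 v, nehari ainf binf p a b l1 v &
    (energy ainf binf p a b l1 v <= energy ainf binf p a b l2 w)%E.
Proof.
move=> l10 l12 [Hw [w0]].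
move=> /(nehari_conditionP _ _ (le_trans l10 l12) Hw)[q2 [q2E rE]].
have q1gt0 := quad_gt0 _ _ l10 Hw w0.
have := le_quad _ _ _ l10 l12 Hw; rewrite q2E => q12.
have q1fin : quad l1 w \is a fin_num.
  by rewrite ge0_fin_numE ?(ltW q1gt0)// (le_lt_trans q12)// ltry.
have [q1 q1E] : exists q1 : R, quad l1 w = q1%:E.
  by exists (fine (quad l1 w)); rewrite fineK.
move: q1gt0 q12; rewrite q1E lte_fin lee_fin => q1gt0 q12.
have q2gt0 : 0 < q2 := lt_le_trans q1gt0 q12.
have p1gt0 : 0 < p - 1 by rewrite subr_gt0.
(* Because [pot w] is [q2], the Nehari condition for [s *: w] at [l1] is
   [s ^+ 2 * q1 = s ^ (p + 1) * q2]; this [s] is its positive root. *)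
pose s := (q1 / q2) `^ (p - 1)^-1.
have s_gt0 : 0 < s by rewrite powR_gt0// divr_gt0.
have s_le1 : s ^+ 2 <= 1.
  rewrite expr_le1 ?(ltW s_gt0)//.
  have -> : 1 = 1 `^ (p - 1)^-1 :> R by rewrite powR1.
  rewrite ge0_ler_powR ?nnegrE ?invr_ge0 ?divr_ge0 ?(ltW p1gt0) ?(ltW q1gt0)
    ?(ltW q2gt0)//.
  by rewrite ler_pdivrMr// mul1r.
have sE : s `^ (p + 1) * q2 = s ^+ 2 * q1.
  rewrite (_ : p + 1 = 2%:R + (p - 1)); last by lra.
  rewrite powRD; last by rewrite (gt_eqF s_gt0) implybT.
  rewrite powR_mulrn ?(ltW s_gt0)//.
  rewrite -powRrM mulVf ?gt_eqF// powRr1 ?divr_ge0 ?ltW//.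
  by field; rewrite gt_eqF.
have s0 : s != 0 by rewrite gt_eqF.
have Hsw := H1Z _ _ _ _ s0 Hw.
have sqE : quad l1 (s *: w) = (s ^+ 2 * q1)%:E by rewrite quadZ// q1E.
have srE : pot (s *: w) = (s ^+ 2 * q1)%:E.
  by rewrite potZ// rE ger0_norm ?(ltW s_gt0)// -EFinM sE.
exists (s *: w).
  split=> //; split.
    (* As [s] is nonzero, [s *: w] can vanish almost everywhere only if [w] does. *)
    apply: contra_not w0; apply: filterS => x /eqP.
    by rewrite -[(s *: w).1 x]/(s * w.1 x) mulf_eq0 (negPf s0) => /eqP.
  by apply/nehari_conditionP => //; exists (s ^+ 2 * q1).
(* Both energies carry the factor [2^-1 - (p + 1)^-1], nonnegative because [p > 1]; what remains is
   [s ^+ 2 * q1 <= q1 <= q2]. *)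
rewrite !energyE sqE srE q2E rE -!EFinM -!EFinB lee_fin -!mulrBl.
rewrite ler_wpM2l//.
  rewrite subr_ge0 lef_pV2 ?posrE//; lra.
apply: (le_trans _ q12); rewrite ler_piMl// ltW//.
Qed.

End scaling.

Theorem proposition3p1 (R : realType) (N : nat) (p ainf binf : R)
    (a b : 'rV[R]_N -> R) :
  (2 <= N)%N ->
  1 < p -> ((3 <= N)%N -> p < (N%:R + 2) / (N%:R - 2)) ->
  0 < ainf -> 0 < binf ->
  a \in Lfun (lebesgue_rV R N) (N%:R / 2)%:E ->
  {ae lebesgue_rV R N, forall x, 0 <= a x} ->
  ~ {ae lebesgue_rV R N, forall x, a x = 0} ->
  ae_vanishes_at_infinity a ->
  b \in Lfun (lebesgue_rV R N) +oo%E ->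
  {ae lebesgue_rV R N, forall x, 0 <= b x} ->
  ~ {ae lebesgue_rV R N, forall x, b x = 0} ->
  ae_vanishes_at_infinity b ->
  forall lambda1 lambda2 : R, 0 <= lambda1 -> lambda1 <= lambda2 ->
    (nehari_level ainf binf p a b lambda1 <=
     nehari_level ainf binf p a b lambda2)%E.
Proof.
move=> _ p1 _ ainf0 binf0 La a0 _ _ Lb b0 _ _ l1 l2 l10 l12.
have ma : measurable_fun setT a.
  by have /sub_Lfun_mfun := La; rewrite inE.
have mb : measurable_fun setT b.
  by have /sub_Lfun_mfun := Lb; rewrite inE.
(* It suffices to bound the energy of each Nehari point for [l2] from below; an empty Nehari set
   gives the level [+oo]. *)
apply/ereal_infP => _ [w Nw <-].
have [v Nv vw] := nehari_projection _ _ _ _ _ _ _ p1 ainf0 binf0 ma mb a0 b0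
  _ _ _ l10 l12 Nw.
by apply: ge_ereal_inf; exists (energy ainf binf p a b l1 v) => //; exists v.
Qed.
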